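(* Let $m,d,r\ge 1$ be integers, let $B_0\in\mathbb{R}^{m\times r}$ have full column rank $r$, and let $A_0\in\mathbb{R}^{r\times d}$ have full row rank $r$. Define the subspaces of $\mathbb{R}^{md}$ $$\mathcal{S}_{A}(B_0)=\{\operatorname{vec}(B_0X):X\in\mathbb{R}^{r\times d}\},\qquad \mathcal{S}_{B}(A_0)=\{\operatorname{vec}(YA_0):Y\in\mathbb{R}^{m\times r}\}.$$ Then $$\frac{\dim\mathcal{S}_{A}(B_0)}{\dim\mathcal{S}_{B}(A_0)}=\frac{rd}{mr}=\frac{d}{m},$$ which equals $32$ when $m=16$ and $d=512$.
   Context: $\operatorname{vec}$ denotes column-stacking vectorization $\mathbb{R}^{m\times d}\to\mathbb{R}^{md}$. With reference prompt $P_0=B_0A_0$, $\mathcal{S}_{A}(B_0)$ is the space of (vectorized) prompt updates $\Delta P=B_0\,\Delta A$ available when $B_0$ is fixed and $A=A_0+\Delta A$ is trained, and $\mathcal{S}_{B}(A_0)$ is the space of updates $\Delta P=\Delta B\,A_0$ available when $A_0$ is fixed and $B=B_0+\Delta B$ is trained. *)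

(* Defs.v *)
From HB Require Import structures.
From mathcomp Require Import all_boot all_order all_algebra.
From mathcomp Require Import reals.

Set Implicit Arguments.
Unset Strict Implicit.
Unset Printing Implicit Defensive.

Import GRing.Theory.
Local Open Scope ring_scope.

Section PromptUpdates.
Variable R : realType.

(* [mxvec] stacks rows, so stacking columns is [mxvec] of the transpose;
   entry (i, j) of P sits at position j * m + i, whence the order d * m. *)
Definition vec m d (P : 'M[R]_(m, d)) : 'cV[R]_(d * m) := (mxvec P^T)^T.

Lemma vecE m d (P : 'M[R]_(m, d)) i j : vec P (mxvec_index j i) 0 = P i j.
Proof. by rewrite mxE mxvecE mxE. Qed.

Lemma vec_is_linear m d : linear (@vec m d).
Proof. by move=> a P Q; rewrite /vec !linearP. Qed.

HB.instance Definition _ m d :=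
  GRing.isLinear.Build R 'M[R]_(m, d) 'cV[R]_(d * m) _ (@vec m d)
    (@vec_is_linear m d).

Definition S_A m r d (B0 : 'M[R]_(m, r)) : {vspace 'cV[R]_(d * m)} :=
  limg (linfun (fun X : 'M[R]_(r, d) => vec (B0 *m X))).

Definition S_B m r d (A0 : 'M[R]_(r, d)) : {vspace 'cV[R]_(d * m)} :=
  limg (linfun (fun Y : 'M[R]_(m, r) => vec (Y *m A0))).

(* [linfun f] agrees with f only when f is linear; the two lemmas below check
   that S_A and S_B are the intended sets. *)
Lemma mem_S_A m r d (B0 : 'M[R]_(m, r)) (v : 'cV[R]_(d * m)) :
  v \in S_A d B0 <-> exists X : 'M[R]_(r, d), v = vec (B0 *m X).
Proof.
have E X : linfun (fun X : 'M[R]_(r, d) => vec (B0 *m X)) X = vec (B0 *m X).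
  by rewrite (lfunE (@vec m d \o mulmx B0)).
split=> [/memv_imgP[X _ ->]|[X ->]]; first by exists X; rewrite E.
by rewrite -E memv_img ?memvf.
Qed.

Lemma mem_S_B m r d (A0 : 'M[R]_(r, d)) (v : 'cV[R]_(d * m)) :
  v \in S_B m A0 <-> exists Y : 'M[R]_(m, r), v = vec (Y *m A0).
Proof.
have E Y : linfun (fun Y : 'M[R]_(m, r) => vec (Y *m A0)) Y = vec (Y *m A0).
  by rewrite (lfunE (@vec m d \o mulmxr A0)).
split=> [/memv_imgP[Y _ ->]|[Y ->]]; first by exists Y; rewrite E.
by rewrite -E memv_img ?memvf.
Qed.

End PromptUpdates.

Arguments S_A {R m r} d B0.
Arguments S_B {R} m {r d} A0.

(* Main.v *)
Require Import Defs.
From mathcomp Require Import all_boot all_order all_algebra.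
From mathcomp Require Import reals.

Import GRing.Theory.
Local Open Scope ring_scope.

(** Full column rank makes [B0] left-cancellable and full row rank makes [A0] right-cancellable. As
    [vec] is injective, both update spaces are injective linear images of full matrix spaces, so
    [dim_limg_inj] gives their dimensions as those of the spaces of factors, [r * d] and [m * r].
    The common factor [r] cancels in the ratio. *)

Lemma dim_limg_inj (K : fieldType) (U V : vectType K) (f : {linear U -> V}) :
  injective f -> \dim (limg (linfun f)) = dim U.
Proof.
move=> f_inj; rewrite limg_dim_eq ?dimvf // capfv; apply/eqP/lker0P => x y.
by rewrite !lfunE => /f_inj.
Qed.

Lemma vec_inj (R : realType) (m d : nat) : injective (@vec R m d).
Proof. by move=> P Q /trmx_inj /(can_inj mxvecK) /trmx_inj. Qed.

Lemma dim_S_A (R : realType) (m d r : nat) (B0 : 'M[R]_(m, r)) :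
  \rank B0 = r -> \dim (S_A d B0) = (r * d)%N.
Proof.
move=> rkB; rewrite -[RHS](dim_matrix R).
(* The composite form carries the linear structure and is convertible to the function in [S_A]. *)
apply: (@dim_limg_inj _ _ _ (@vec R m d \o mulmx B0)) => X Y /vec_inj.
(* Rank equal to the number of columns means that the rows span, hence [row_full]. *)
by apply: row_full_inj; rewrite /row_full rkB.
Qed.

Lemma dim_S_B (R : realType) (m d r : nat) (A0 : 'M[R]_(r, d)) :
  \rank A0 = r -> \dim (S_B m A0) = (m * r)%N.
Proof.
move=> rkA; rewrite -[RHS](dim_matrix R).
apply: (@dim_limg_inj _ _ _ (@vec R m d \o mulmxr A0)) => X Y /vec_inj.
by apply: row_free_inj; rewrite /row_free rkA.
Qed.

Theorem corollary2 (R : realType) (m d r : nat)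
    (hm : (1 <= m)%N) (hd : (1 <= d)%N) (hr : (1 <= r)%N)
    (B0 : 'M[R]_(m, r)) (A0 : 'M[R]_(r, d))
    (hB0 : \rank B0 = r) (hA0 : \rank A0 = r) :
  [/\ (\dim (S_A d B0))%:R / (\dim (S_B m A0))%:R
        = (r * d)%:R / (m * r)%:R :> rat,
      (r * d)%:R / (m * r)%:R = d%:R / m%:R :> rat
    & m = 16%N -> d = 512%N ->
      (\dim (S_A d B0))%:R / (\dim (S_B m A0))%:R = 32%:R :> rat].
Proof.
have cancel_r : (r * d)%:R / (m * r)%:R = d%:R / m%:R :> rat.
  (* Splits off the factor [r / r], which is 1 by [hr]. *)
  by rewrite mulnC !natrM -mulf_div divff ?mulr1 // Num.Theory.pnatr_eq0 -lt0n.
rewrite (dim_S_A _ _ _ _ _ hB0) (dim_S_B _ _ _ _ _ hA0).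
by split=> // m16 d512; rewrite cancel_r m16 d512.
Qed.
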